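(* Let $G$ be a regular Lie group with Lie algebra $\mathfrak g=\mathbf T_eG$. For all $X,Y\in\mathfrak g$ and all $d_1\in D$, $$\exp\big(d_1(X+Y)\big)=\exp(d_1X).\exp(d_1Y).$$
   Context: We work in synthetic differential geometry. $\mathbb R$ is the line: a commutative ring in which positive integers are invertible, satisfying the (general) Kock-Lawvere axiom. $D=\{d\in\mathbb R\mid d^2=0\}$. A space $M$ is microlinear if every finite diagram of infinitesimal spaces that $\mathbb R$ perceives as a colimit is also perceived as a colimit by $M$. A Lie group is a group which is microlinear as a space; its unit is $e$ and its product is written with a dot. $\mathfrak g=\mathbf T_eG$ is the set of maps $X:D\to G$, $d\mapsto X_d$, with $X_0=e$; it is an $\mathbb R$-module with $(\alpha X)_d=X_{\alpha d}$ and $(X+Y)_d=X_d.Y_d=Y_d.X_d$. A Lie group $G$ is regular if for every map $\varsigma:\mathbb R\to\mathfrak g$ there is a map $\theta:\mathbb R\to G$ with $\theta(0)=e$ and $\theta(t+d)=\theta(t).\varsigma(t)_d$ for all $t\in\mathbb R$, $d\in D$. For $X\in\mathfrak g$, if $\theta:\mathbb R\to G$ is a one-parameter subgroup (a homomorphism from the additive group of $\mathbb R$) with $\theta(d)=X_d$ for all $d\in D$, then $\exp X$ denotes $\theta(1)$; when $G$ is regular, $\exp:\mathfrak g\to G$ is a total function. *)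

(* Defs.v *)
From Stdlib Require Import Ring_theory List Vector Fin.

Set Implicit Arguments.
Unset Strict Implicit.

(* Everything here is to be read in intuitionistic logic: excluded middle makes
   the Kock-Lawvere axiom false unless 0 = 1 in the line.  This is why the
   rings below carry no decidable equality. *)

Record CRing : Type := {
  rcar :> Type;
  rzero : rcar;
  rone : rcar;
  radd : rcar -> rcar -> rcar;
  rmul : rcar -> rcar -> rcar;
  rsub : rcar -> rcar -> rcar;
  ropp : rcar -> rcar;
  rring : ring_theory rzero rone radd rmul rsub ropp (@eq rcar)
}.

Arguments rzero {_}.
Arguments rone {_}.

Declare Scope line_scope.
Delimit Scope line_scope with line.
Bind Scope line_scope with rcar.
Notation "0" := rzero : line_scope.
Notation "1" := rone : line_scope.
Infix "+" := radd : line_scope.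
Infix "*" := rmul : line_scope.
Local Open Scope line_scope.

Definition vzero (R : CRing) (n : nat) : Vector.t R n := Vector.const 0 n.

Definition vadd (R : CRing) (n : nat) (v w : Vector.t R n) : Vector.t R n :=
  Vector.map2 (@radd R) v w.

Definition vscale (R : CRing) (n : nat) (a : R) (v : Vector.t R n) : Vector.t R n :=
  Vector.map (rmul a) v.

Arguments vzero {_ _}.

(* A Weil algebra over R: a commutative R-algebra structure on the module
   R^(1+n) with unit (1,0,...,0), in which the vectors with first coordinate 0
   form a nilpotent ideal. *)
Record WeilAlgebra (R : CRing) : Type := {
  wdim : nat;
  wcar :> Type := Vector.t R (S wdim);
  wone : wcar := Vector.cons R 1 wdim vzero;
  wmul : wcar -> wcar -> wcar;
  wmul_comm : forall x y, wmul x y = wmul y x;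
  wmul_assoc : forall x y z, wmul x (wmul y z) = wmul (wmul x y) z;
  wmul_one : forall x, wmul wone x = x;
  wmul_add : forall x y z, wmul (vadd x y) z = vadd (wmul x z) (wmul y z);
  wmul_scale : forall a x y, wmul (vscale a x) y = vscale a (wmul x y);
  waug_ideal : forall x y : wcar, Vector.hd x = 0 -> Vector.hd (wmul x y) = 0;
  waug_nilpotent : exists N : nat, forall l : list wcar,
    length l = N -> List.Forall (fun x => Vector.hd x = 0) l ->
    List.fold_right wmul wone l = vzero
}.

(* The infinitesimal space Spec_R(W) of R-algebra homomorphisms W -> R. *)
Record Spec (R : CRing) (W : WeilAlgebra R) : Type := {
  spec_fun :> W -> R;
  spec_add : forall x y : W, spec_fun (vadd x y) = spec_fun x + spec_fun y;
  spec_scale : forall (a : R) (x : W), spec_fun (vscale a x) = a * spec_fun x;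
  spec_mul : forall x y : W, spec_fun (wmul x y) = spec_fun x * spec_fun y;
  spec_one : spec_fun (wone W) = 1
}.

(* The evaluation homomorphism W -> R^(Spec_R W) is bijective, for every W. *)
Definition KockLawvere (R : CRing) : Prop :=
  forall (W : WeilAlgebra R) (f : Spec W -> R),
    exists! w : W, forall p : Spec W, p w = f p.

Definition rnat (R : CRing) (n : nat) : R := Nat.iter n (radd 1) 0.

Record Line : Type := {
  line_ring :> CRing;
  line_int_inv : forall n : nat, exists r : line_ring, rnat line_ring (S n) * r = 1;
  line_KL : KockLawvere line_ring
}.

Unset Implicit Arguments.

(* A cocone of infinitesimal spaces over a finite diagram, the diagram being
   given by a finite directed multigraph.  No composition is recorded: it does not
   affect which families are compatible with the arrows. *)
Record InfCocone (R : CRing) : Type := {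
  nobj : nat;
  narr : nat;
  src : Fin.t narr -> Fin.t nobj;
  tgt : Fin.t narr -> Fin.t nobj;
  obj : Fin.t nobj -> WeilAlgebra R;
  arr : forall a : Fin.t narr, Spec (obj (src a)) -> Spec (obj (tgt a));
  apex : WeilAlgebra R;
  leg : forall i : Fin.t nobj, Spec (obj i) -> Spec apex;
  leg_arr : forall (a : Fin.t narr) (x : Spec (obj (src a))),
    leg (tgt a) (arr a x) = leg (src a) x
}.

Arguments nobj {R} _.
Arguments narr {R} _.
Arguments src {R} _ _.
Arguments tgt {R} _ _.
Arguments obj {R} _ _.
Arguments arr {R} _ _ _.
Arguments apex {R} _.
Arguments leg {R} _ _ _.

(* M^apex, with the maps induced by the legs, is the limit of the M^(obj i). *)
Definition perceives_colimit {R : CRing} (M : Type) (C : InfCocone R) : Prop :=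
  forall g : (forall i : Fin.t (nobj C), Spec (obj C i) -> M),
    (forall (a : Fin.t (narr C)) (x : Spec (obj C (src C a))),
       g (tgt C a) (arr C a x) = g (src C a) x) ->
    exists! h : Spec (apex C) -> M,
      forall (i : Fin.t (nobj C)) (x : Spec (obj C i)), h (leg C i x) = g i x.

Definition microlinear (R : CRing) (M : Type) : Prop :=
  forall C : InfCocone R, perceives_colimit R C -> perceives_colimit M C.

Record LieGroup (R : Line) : Type := {
  gcar :> Type;
  gone : gcar;
  gmul : gcar -> gcar -> gcar;
  ginv : gcar -> gcar;
  gmul_assoc : forall x y z, gmul x (gmul y z) = gmul (gmul x y) z;
  gone_l : forall x, gmul gone x = x;
  gone_r : forall x, gmul x gone = x;
  ginv_l : forall x, gmul (ginv x) x = gone;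
  ginv_r : forall x, gmul x (ginv x) = gone;
  gmicrolinear : microlinear R gcar
}.

Arguments gone {R _}.
Arguments gmul {R _} _ _.
Arguments ginv {R _} _.

Declare Scope group_scope.
Delimit Scope group_scope with group.
Bind Scope group_scope with gcar.
Infix "*" := gmul : group_scope.

Record D (R : CRing) : Type := {
  dval :> R;
  dsq : dval * dval = 0
}.

Arguments dval {R} _.
Arguments dsq {R} _.

Lemma rmul_zero {R : CRing} (x : R) : x * 0 = 0.
Proof.
  destruct (rring R) as [add0 addC addA _ mulC _ dist _ oppr].
  assert (E : 0 * x + 0 * x = 0 * x) by (rewrite <- dist, add0; reflexivity).
  rewrite mulC, <- (add0 (0 * x)), <- (oppr (0 * x)) at 1.
  rewrite (addC (0 * x) (ropp _)), <- addA, E, addC, oppr. reflexivity.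
Qed.

Lemma scaleD_sq {R : CRing} (a : R) (d : D R) : (a * d) * (a * d) = 0.
Proof.
  destruct (rring R) as [_ _ _ _ mulC mulA _ _ _].
  rewrite <- mulA, (mulA d a d), (mulC d a), <- (mulA a d d), dsq, !rmul_zero.
  reflexivity.
Qed.

Definition scaleD {R : CRing} (a : R) (d : D R) : D R :=
  {| dval := a * d; dsq := scaleD_sq a d |}.

(* X_0 = e is required at every d : D whose underlying element is 0, whichever
   proof of d * d = 0 it carries. *)
Record tangent {R : Line} (G : LieGroup R) : Type := {
  tval :> D R -> G;
  tval_zero : forall d : D R, dval d = 0 -> tval d = gone
}.

Arguments tval {R G} _ _.
Arguments tval_zero {R G} _ _ _.

Lemma tscale_zero {R : Line} {G : LieGroup R} (a : R) (X : tangent G) (d : D R) :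
  dval d = 0 -> X (scaleD a d) = gone.
Proof.
  intro H. apply tval_zero. simpl. rewrite H. apply rmul_zero.
Qed.

Definition tscale {R : Line} {G : LieGroup R} (a : R) (X : tangent G) : tangent G :=
  {| tval := fun d => X (scaleD a d); tval_zero := tscale_zero a X |}.

Lemma tadd_zero {R : Line} {G : LieGroup R} (X Y : tangent G) (d : D R) :
  dval d = 0 -> (X d * Y d)%group = gone.
Proof. intro H. rewrite !tval_zero by exact H. apply gone_l. Qed.

Definition tadd {R : Line} {G : LieGroup R} (X Y : tangent G) : tangent G :=
  {| tval := fun d => (X d * Y d)%group; tval_zero := tadd_zero X Y |}.

Definition regular {R : Line} (G : LieGroup R) : Prop :=
  forall s : R -> tangent G,
    exists theta : R -> G,
      theta 0 = gone /\
      forall (t : R) (d : D R), theta (t + d) = (theta t * s t d)%group.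

Definition one_parameter_subgroup {R : Line} (G : LieGroup R) (theta : R -> G) : Prop :=
  forall s t : R, theta (s + t) = (theta s * theta t)%group.

(* exp X is theta(1) for any one-parameter subgroup theta with velocity X; that
   this is independent of theta is part of exp being a function. *)
Definition is_exponential {R : Line} (G : LieGroup R) (exp : tangent G -> G) : Prop :=
  forall (X : tangent G) (theta : R -> G),
    one_parameter_subgroup G theta ->
    (forall d : D R, theta d = X d) ->
    exp X = theta 1.

(* Main.v *)
Require Import Defs.
From Stdlib Require Import Ring List Vector Fin.
From Stdlib Require Import FunctionalExtensionality ProofIrrelevance.

(** The map [t |-> X_(t d1)] is itself a one-parameter subgroup with velocity
    [d1 X]: since [t d1] and [s d1] annihilate each other, the pair lies in
    D(2), and on D(2) the identity [X_(a+b) = X_a . X_b] holds because a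
    microlinear space perceives D(2) as the gluing of its two axes at the
    origin.  Hence [exp (d1 X) = X_d1], and the theorem is the definition of
    [X + Y] evaluated at [d1].

    Excluded middle would make the line trivial, so the argument stays
    intuitionistic; proof irrelevance and function extensionality only serve to
    identify points of infinitesimal spaces having equal coordinates, and maps
    having equal values. *)

Import VectorNotations.
Local Open Scope line_scope.

Section CommutativeRing.

Context (R : CRing).

Add Ring line_ring : (rring R).

Lemma D_eq (d d' : D R) : dval d = dval d' -> d = d'.
Proof.
  destruct d as [x p], d' as [y q]; simpl; intros ->.
  f_equal; apply proof_irrelevance.
Qed.

Lemma Spec_eq (W : WeilAlgebra R) (p q : Spec W) :
  (forall w : W, p w = q w) -> p = q.
Proof.
  destruct p as [f fa fs fm fo], q as [g ga gs gm go]; simpl; intro E.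
  assert (f = g) as <- by (apply functional_extensionality; exact E).
  f_equal; apply proof_irrelevance.
Qed.

(** The rule (a + u)(b + v) = ab + (av + bu) of the square-zero extension of [R] by R^n. *)
Definition sqz_mul {n : nat} (x y : Vector.t R (S n)) : Vector.t R (S n) :=
  Vector.hd x * Vector.hd y ::
  vadd (vscale (Vector.hd x) (Vector.tl y)) (vscale (Vector.hd y) (Vector.tl x)).

Ltac by_coordinates :=
  repeat match goal with
  | x : Vector.t _ (S _) |- _ =>
      let a := fresh "a" in let u := fresh "u" in
      pattern x; apply Vector.caseS'; clear x; intros a u
  end;
  unfold sqz_mul, vadd, vscale, vzero; simpl; f_equal;
  [ring | apply Vector.eq_nth_iff; intros i ? <-;
    repeat (erewrite ?Vector.nth_map2, ?Vector.nth_map, ?Vector.const_nth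
      by reflexivity);
    ring].

Lemma sqz_comm n (x y : Vector.t R (S n)) : sqz_mul x y = sqz_mul y x.
Proof. by_coordinates. Qed.

Lemma sqz_assoc n (x y z : Vector.t R (S n)) :
  sqz_mul x (sqz_mul y z) = sqz_mul (sqz_mul x y) z.
Proof. by_coordinates. Qed.

Lemma sqz_one n (x : Vector.t R (S n)) : sqz_mul (1 :: vzero) x = x.
Proof. by_coordinates. Qed.

Lemma sqz_add n (x y z : Vector.t R (S n)) :
  sqz_mul (vadd x y) z = vadd (sqz_mul x z) (sqz_mul y z).
Proof. by_coordinates. Qed.

Lemma sqz_scale n (a : R) (x y : Vector.t R (S n)) :
  sqz_mul (vscale a x) y = vscale a (sqz_mul x y).
Proof. by_coordinates. Qed.

Lemma sqz_ideal n (x y : Vector.t R (S n)) :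
  Vector.hd x = 0 -> Vector.hd (sqz_mul x y) = 0.
Proof. simpl; intros ->; ring. Qed.

Lemma sqz_aug_sq n (x y : Vector.t R (S n)) :
  Vector.hd x = 0 -> Vector.hd y = 0 -> sqz_mul x y = vzero.
Proof.
  intros Hx Hy; unfold sqz_mul; rewrite Hx, Hy; clear Hx Hy; by_coordinates.
Qed.

Lemma sqz_nilpotent n : exists N : nat, forall l : list (Vector.t R (S n)),
  length l = N -> List.Forall (fun x => Vector.hd x = 0) l ->
  List.fold_right sqz_mul (1 :: vzero) l = vzero.
Proof.
  (* Two augmentation elements already multiply to 0; commutativity moves the trailing unit of the
     fold to the left, where it cancels. *)
  exists 2%nat; intros [|x [|y [|z l]]]; try discriminate; intros _ H.
  inversion_clear H as [|? ? Hx H']; inversion_clear H' as [|? ? Hy _].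
  simpl List.fold_right; rewrite (sqz_comm _ y), sqz_one.
  now apply sqz_aug_sq.
Qed.

(* The spectrum of this algebra is D(n) = {d in R^n | d_i d_j = 0}. *)
Definition sqz (n : nat) : WeilAlgebra R :=
  {| wdim := n; wmul := sqz_mul; wmul_comm := @sqz_comm n;
     wmul_assoc := @sqz_assoc n; wmul_one := @sqz_one n;
     wmul_add := @sqz_add n; wmul_scale := @sqz_scale n;
     waug_ideal := @sqz_ideal n; waug_nilpotent := sqz_nilpotent n |}.

Ltac split_vectors :=
  repeat match goal with
  | x : wcar (sqz ?n) |- _ => change (Vector.t R (S n)) in x
  | x : Vector.t _ (S _) |- _ =>
      let a := fresh "a" in let u := fresh "u" in
      pattern x; apply Vector.caseS'; clear x; intros a u
  | x : Vector.t _ O |- _ => pattern x; apply Vector.case0; clear x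
  end.

Definition origin (n : nat) : Spec (sqz n).
Proof.
  refine {| spec_fun := fun w : sqz n => Vector.hd (w : Vector.t R (S n)) |};
    simpl; intros; split_vectors; reflexivity.
Defined.

Definition point2 (x y : R) (Hx : x * x = 0) (Hy : y * y = 0) (Hxy : x * y = 0) :
  Spec (sqz 2).
Proof.
  refine {| spec_fun := fun w : sqz 2 =>
    let w : Vector.t R 3 := w in
    Vector.hd w + Vector.hd (Vector.tl w) * x
      + Vector.hd (Vector.tl (Vector.tl w)) * y |}; simpl; intros.
  - split_vectors; simpl; ring.
  - split_vectors; simpl; ring.
  - split_vectors; simpl.
    (* The product is expanded with x^2, y^2 and xy isolated, so that the hypotheses can be
       rewritten before [ring] finishes. *)
    match goal with |- _ = (?a + ?b * x + ?c * y) * (?a' + ?b' * x + ?c' * y) =>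
      transitivity (a * a' + (a * b' + a' * b) * x + (a * c' + a' * c) * y
        + b * b' * (x * x) + c * c' * (y * y) + (b * c' + b' * c) * (x * y))
    end; [rewrite Hx, Hy, Hxy|]; ring.
  - ring.
Defined.

(** Sets the second generator to 0: the algebra map dual to the inclusion of the first axis in
    D(2). *)
Definition coord1 (w : Vector.t R 3) : Vector.t R 2 :=
  [Vector.hd w; Vector.hd (Vector.tl w)].

Definition coord2 (w : Vector.t R 3) : Vector.t R 2 :=
  [Vector.hd w; Vector.hd (Vector.tl (Vector.tl w))].

Definition axis1 (p : Spec (sqz 1)) : Spec (sqz 2).
Proof.
  refine {| spec_fun := fun w : sqz 2 => p (coord1 w) |}; intros.
  - rewrite <- spec_add; f_equal; split_vectors; reflexivity.
  - rewrite <- spec_scale; f_equal; split_vectors; reflexivity.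
  - rewrite <- spec_mul; f_equal; split_vectors; reflexivity.
  - apply (spec_one p).
Defined.

Definition axis2 (p : Spec (sqz 1)) : Spec (sqz 2).
Proof.
  refine {| spec_fun := fun w : sqz 2 => p (coord2 w) |}; intros.
  - rewrite <- spec_add; f_equal; split_vectors; reflexivity.
  - rewrite <- spec_scale; f_equal; split_vectors; reflexivity.
  - rewrite <- spec_mul; f_equal; split_vectors; reflexivity.
  - apply (spec_one p).
Defined.

Definition cross_leg (i : Fin.t 3) : Spec (sqz 1) -> Spec (sqz 2) :=
  Fin.caseS' i (fun _ => Spec (sqz 1) -> Spec (sqz 2))
    (fun _ => origin 2)
    (fun j => Fin.caseS' j (fun _ => Spec (sqz 1) -> Spec (sqz 2))
      axis1 (fun _ => axis2)).

Lemma cross_leg_arr (a : Fin.t 2) (x : Spec (sqz 1)) :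
  cross_leg (Fin.FS a) (origin 1) = cross_leg Fin.F1 x.
Proof.
  apply (Fin.caseS' a); [|intro b]; apply Spec_eq; reflexivity.
Qed.

(* Two copies of D glued at 0.  The gluing point is a third copy of D, which the
   constant arrows collapse. *)
Definition cross : InfCocone R :=
  {| nobj := 3; narr := 2; src := fun _ => Fin.F1; tgt := Fin.FS;
     obj := fun _ => sqz 1; arr := fun _ _ => origin 1;
     apex := sqz 2; leg := cross_leg; leg_arr := cross_leg_arr |}.

(** By Kock-Lawvere, functions on the two axes have the form a + bx and a' + cy; agreement at the
    origin forces a = a', so they glue to a + bx + cy. *)
Lemma line_perceives_cross : KockLawvere R -> perceives_colimit R cross.
Proof.
  intros KL g compat.
  destruct (KL (sqz 1) (g (Fin.FS Fin.F1))) as [w1 [E1 U1]].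
  destruct (KL (sqz 1) (g (Fin.FS (Fin.FS Fin.F1)))) as [w2 [E2 U2]].
  assert (E : Vector.hd (w1 : Vector.t R 2) = Vector.hd (w2 : Vector.t R 2)).
  { pose proof (compat Fin.F1 (origin 1)) as C1.
    pose proof (compat (Fin.FS Fin.F1) (origin 1)) as C2.
    change (origin 1 w1 = origin 1 w2).
    rewrite E1, E2. exact (eq_trans C1 (eq_sym C2)). }
  set (w := [Vector.hd (w1 : Vector.t R 2); Vector.hd (Vector.tl (w1 : Vector.t R 2));
             Vector.hd (Vector.tl (w2 : Vector.t R 2))] : sqz 2).
  assert (P1 : coord1 w = w1).
  { unfold w, coord1; clear; split_vectors; reflexivity. }
  assert (P2 : coord2 w = w2).
  { unfold w, coord2; rewrite E; clear; split_vectors; reflexivity. }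
  exists (fun p => p w); split.
  - intro i; apply (Fin.caseS' i); [|intro j; apply (Fin.caseS' j)].
    + intro x; exact (eq_trans (E1 (origin 1)) (compat Fin.F1 x)).
    + intro x; refine (eq_trans _ (E1 x)); rewrite <- P1; reflexivity.
    + intro k; apply (Fin.caseS' k); [|intro l; inversion l].
      intro x; refine (eq_trans _ (E2 x)); rewrite <- P2; reflexivity.
  - intros h Hh; apply functional_extensionality; intro p.
    (* Any other gluing [h] is also given by some [v], and its restrictions to the axes determine
       all three coefficients. *)
    destruct (KL (sqz 2) h) as [v [Ev _]].
    assert (V1 : w1 = coord1 v).
    { apply U1; intro q.
      exact (eq_trans (Ev (axis1 q)) (Hh (Fin.FS Fin.F1) q)). }
    assert (V2 : w2 = coord2 v).
    { apply U2; intro q.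
      exact (eq_trans (Ev (axis2 q)) (Hh (Fin.FS (Fin.FS Fin.F1)) q)). }
    rewrite <- Ev; f_equal.
    unfold w; rewrite V1, V2; clear; split_vectors; reflexivity.
Qed.

(** Both maps extend the same compatible family on [cross], so uniqueness in the universal property
    identifies them. *)
Lemma microlinear_D2_ext (M : Type) (f k : Spec (sqz 2) -> M) :
  KockLawvere R -> microlinear R M ->
  (forall q, f (axis1 q) = k (axis1 q)) ->
  (forall q, f (axis2 q) = k (axis2 q)) ->
  f = k.
Proof.
  intros KL ML A1 A2.
  destruct (ML cross (line_perceives_cross KL) (fun i x => f (cross_leg i x)))
    as [h [_ U]].
  { intros a x; apply (f_equal f); apply cross_leg_arr. }
  rewrite <- (U f), <- (U k); [reflexivity| |reflexivity].
  intro i; apply (Fin.caseS' i); [|intro j; apply (Fin.caseS' j)].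
  - intro x; change (k (origin 2) = f (origin 2)).
    (* The central leg is constant at the origin, which lies on the first axis. *)
    assert (E : origin 2 = axis1 (origin 1)) by (apply Spec_eq; reflexivity).
    rewrite E; symmetry; apply A1.
  - intro x; symmetry; apply A1.
  - intros l x; symmetry; apply A2.
Qed.

Lemma spec_aug_mul n (p : Spec (sqz n)) (u v : Vector.t R n) :
  p (0 :: u) * p (0 :: v) = 0.
Proof.
  rewrite <- spec_mul; simpl wmul; rewrite sqz_aug_sq by reflexivity.
  replace vzero with (vscale 0 (0 :: u)).
  - rewrite (spec_scale p); ring.
  - by_coordinates.
Qed.

(** The linear form with coefficients [u], evaluated at the point [p] of D(n). *)
Definition D_of_Spec n (u : Vector.t R n) (p : Spec (sqz n)) : D R :=
  {| dval := p (0 :: u); dsq := spec_aug_mul n p u u |}.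

End CommutativeRing.

Section Group.

Context {R : Line} {G : LieGroup R}.

Add Ring line_ring' : (rring R).

(** The maps (x, y) |-> X_(x+y) and (x, y) |-> X_x . X_y on D(2) agree on both axes because X_0 =
    e. *)
Lemma tangent_add (X : tangent G) (a b c : D R) :
  dval a * dval b = 0 -> dval c = dval a + dval b -> X c = (X a * X b)%group.
Proof.
  intros Hab Hc.
  set (f := fun p => X (D_of_Spec R 2 [1; 1] p)).
  set (k := fun p => (X (D_of_Spec R 2 [1; 0] p) * X (D_of_Spec R 2 [0; 1] p))%group).
  assert (Z : forall q : Spec (sqz R 1), q [0; 0] = 0).
  { intro q. replace ([0; 0] : sqz R 1) with (vscale 0 ([0; 0] : sqz R 1)).
    - rewrite spec_scale; ring.
    - unfold vscale; simpl; repeat f_equal; ring. }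
  assert (E : f = k).
  { apply microlinear_D2_ext; [apply line_KL | apply gmicrolinear | |];
      intro q; unfold f, k.
    - rewrite (tval_zero X (D_of_Spec R 2 [0; 1] _)), gone_r by apply Z.
      f_equal; apply D_eq; reflexivity.
    - rewrite (tval_zero X (D_of_Spec R 2 [1; 0] _)), gone_l by apply Z.
      f_equal; apply D_eq; reflexivity. }
  (* Evaluation at (a, b), a point of D(2) because ab = 0. *)
  apply (f_equal (fun F => F (point2 R (dval a) (dval b) (dsq a) (dsq b) Hab))) in E.
  unfold f, k in E.
  refine (eq_trans _ (eq_trans E _)); [|f_equal]; f_equal; apply D_eq; simpl;
    rewrite ?Hc; ring.
Qed.

Lemma exp_infinitesimal (exp : tangent G -> G) (Hexp : is_exponential G exp)
  (X : tangent G) (d : D R) : exp (tscale d X) = X d.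
Proof.
  rewrite (Hexp (tscale d X) (fun t => X (scaleD t d))).
  - f_equal; apply D_eq; simpl; ring.
  - intros s t; apply tangent_add; simpl; [|ring].
    (* The products s d and t d annihilate each other since d^2 = 0. *)
    transitivity (s * t * (dval d * dval d)); [ring|].
    rewrite dsq; ring.
  - intro d'; simpl; f_equal; apply D_eq; simpl; ring.
Qed.

End Group.

Theorem theorem33 (R : Line) (G : LieGroup R) (Greg : regular G)
  (exp : tangent G -> G) (Hexp : is_exponential G exp)
  (X Y : tangent G) (d1 : D R) :
  exp (tscale d1 (tadd X Y)) = gmul (exp (tscale d1 X)) (exp (tscale d1 Y)).
Proof.
  rewrite !exp_infinitesimal by exact Hexp.
  reflexivity.
Qed.
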